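(* Let $\boldsymbol\gamma=\{\gamma_n\}_{n=0}^\infty$ be a sequence of real numbers such that $\gamma_n>0$ for all $n\in\mathbb{Z}_+$ and $$\gamma_n = 1 + bn + cn^2 + \int_{\mathbb{R}_+} Q_n\, d\nu,\quad n\in\mathbb{Z}_+,$$ where $b\in\mathbb{R}$, $c\in\mathbb{R}_+$ and $\nu$ is a compactly supported finite Borel measure on $\mathbb{R}_+$ such that $\nu(\{1\})=0$. Then the sequence $\boldsymbol\lambda=\{\lambda_n\}_{n=0}^\infty$ defined by $$\lambda_n=\sqrt{\frac{\gamma_{n+1}}{\gamma_n}},\quad n\in\mathbb{Z}_+,$$ is bounded and the unilateral weighted shift $W_{\boldsymbol\lambda}$ is conditionally positive definite (CPD). Moreover, $\hat{\boldsymbol\lambda}=\boldsymbol\gamma$.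
   Context: $\mathbb{Z}_+=\{0,1,2,\dots\}$, $\mathbb{R}_+=[0,\infty)$; all measures are positive. The polynomials $Q_n$ are $Q_0=Q_1=0$ and $Q_n(x)=\sum_{j=0}^{n-2}(n-j-1)x^j$ for $n\geq 2$. A real sequence $\{\gamma_n\}_{n=0}^\infty$ is conditionally positive definite (CPD) if $\sum_{i,j=0}^k \gamma_{i+j}\alpha_i\bar\alpha_j\geq 0$ for every finite sequence $\alpha_0,\dots,\alpha_k\in\mathbb{C}$ with $\sum_{j=0}^k\alpha_j=0$. A bounded linear operator $T$ on a complex Hilbert space $\mathcal{H}$ is CPD if the sequence $\{\|T^nh\|^2\}_{n=0}^\infty$ is CPD for every $h\in\mathcal{H}$. For a bounded sequence $\boldsymbol\lambda=\{\lambda_n\}_{n=0}^\infty$ of positive reals, $W_{\boldsymbol\lambda}$ is the bounded operator on $\ell^2$ with $W_{\boldsymbol\lambda}e_n=\lambda_ne_{n+1}$, $n\in\mathbb{Z}_+$, where $\{e_n\}_{n=0}^\infty$ is the standard orthonormal basis of $\ell^2$. The associated sequence $\hat{\boldsymbol\lambda}=\{\hat\lambda_n\}_{n=0}^\infty$ is $\hat\lambda_0=1$, $\hat\lambda_n=\lambda_0^2\cdots\lambda_{n-1}^2$ for $n\geq1$. *)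

(* Defs.v *)
From HB Require Import structures.
From mathcomp Require Import all_boot all_order all_algebra.
From mathcomp Require Import all_classical all_reals all_analysis.
From mathcomp Require Import complex.

Set Implicit Arguments.
Unset Strict Implicit.
Unset Printing Implicit Defensive.

Import Order.TTheory GRing.Theory Num.Theory.
Import numFieldNormedType.Exports.
Import Normc.

Local Open Scope classical_set_scope.
Local Open Scope ring_scope.
Local Open Scope complex_scope.

(* The index bound n.-1 makes the sum empty for n = 0 and n = 1, and for
   j < n.-1 the natural number n - j - 1 is not truncated. *)
Definition Qpoly (R : realType) (n : nat) : {poly R} :=
  \sum_(j < n.-1) (n - j - 1)%N%:R *: 'X^j.

(* In R[i], 0 <= z means that z is real and nonnegative. *)
Definition cpd_seq (R : realType) (g : nat -> R) : Prop :=
  forall (k : nat) (a : 'I_k.+1 -> R[i]), \sum_(j < k.+1) a j = 0 ->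
    0 <= \sum_(i < k.+1) \sum_(j < k.+1) (g (i + j)%N)%:C * a i * (a j)^*.

Definition bounded_operator (R : realType) (V : normedModType R[i])
    (T : {linear V -> V}) : Prop :=
  exists M : R, forall h : V, `|T h| <= M%:C * `|h|.

(* The norm of V takes its values in the nonnegative reals of R[i], hence the
   projection Re. Of the Hilbert space structure, only the norm is used. *)
Definition cpd_operator (R : realType) (V : normedModType R[i])
    (T : {linear V -> V}) : Prop :=
  forall h : V, cpd_seq (fun n => complex.Re `|iter n T h| ^+ 2).

Definition compactly_supported (R : realType)
    (nu : set (measurableTypeR R) -> \bar R) : Prop :=
  exists2 K : set R, compact K & nu (~` K) = 0%E.

(* Measures on [0, +oo[ are identified with measures on the whole line that
   vanish on ]-oo, 0[. *)
Definition measure_on_Rplus (R : realType)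
    (nu : set (measurableTypeR R) -> \bar R) : Prop :=
  nu `]-oo, 0[%classic = 0%E.

Section ell2.
Variable R : realType.
Implicit Types (h : nat -> R[i]) (N : nat).

Definition square_series h : R^nat := series (fun n => normc (h n) ^+ 2).

Definition square_summable h : Prop := cvgn (square_series h).

Definition ell2_pred : {pred nat -> R[i]} := [pred h | `[< square_summable h >]].

Let pnorm h N : R := Num.sqrt (square_series h N).

Let square_series_ge0 h N : 0 <= square_series h N.
Proof. by apply: sumr_ge0 => i _; exact: sqr_ge0. Qed.

Let square_seriesS h N :
  square_series h N.+1 = square_series h N + normc (h N) ^+ 2.
Proof. by rewrite /square_series /series /= big_nat_recr. Qed.

Let square_series_nd h : nondecreasing_seq (square_series h).
Proof.
by apply/nondecreasing_seqP => n; rewrite square_seriesS lerDl sqr_ge0.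
Qed.

Let normcR_ge0 (z : R[i]) : 0 <= normc z.
Proof. by case: z => a b /=; exact: sqrtr_ge0. Qed.

Let pnormS h N : pnorm h N.+1 = normc (pnorm h N +i* normc (h N)).
Proof. by rewrite /pnorm square_seriesS /= sqr_sqrtr. Qed.

Let pnorm_triangle h1 h2 N : pnorm (h1 + h2) N <= pnorm h1 N + pnorm h2 N.
Proof.
elim: N => [|N IH].
  by rewrite /pnorm /square_series /series /= !big_geq// sqrtr0 addr0.
rewrite !pnormS.
apply: le_trans (le_normcD (pnorm h1 N +i* normc (h1 N))
                           (pnorm h2 N +i* normc (h2 N))).
rewrite /= ler_wsqrtr// lerD// lerXn2r ?nnegrE ?addr_ge0 ?sqrtr_ge0//.
exact: le_normcD.
Qed.

Let summableP h (M : R) :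
  (forall N, pnorm h N <= M) -> square_summable h.
Proof.
move=> hM; apply: nondecreasing_is_cvgn; first exact: square_series_nd.
exists (M ^+ 2) => _ [n _ <-]; rewrite -[leLHS]sqr_sqrtr//.
by rewrite lerXn2r ?nnegrE ?sqrtr_ge0 ?hM// (le_trans (sqrtr_ge0 _) (hM 0%N)).
Qed.

Definition square_norm h : R := Num.sqrt (limn (square_series h)).

Let pnorm_le h N : square_summable h -> pnorm h N <= square_norm h.
Proof.
move=> sh; rewrite /pnorm /square_norm ler_wsqrtr//.
by apply: nondecreasing_cvgn_le => //; exact: square_series_nd.
Qed.

Let square_norm_le h M : (forall N, pnorm h N <= M) -> square_norm h <= M.
Proof.
move=> hM; have sh := summableP hM.
have M0 : 0 <= M by apply: le_trans (hM 0%N); exact: sqrtr_ge0.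
rewrite /square_norm -[leRHS](ger0_norm M0) -sqrtr_sqr ler_wsqrtr//.
apply: limr_le => //; apply: nearW => n; rewrite -[leLHS]sqr_sqrtr//.
by rewrite lerXn2r ?nnegrE ?sqrtr_ge0 ?hM.
Qed.

Let square_seriesZ (l : R[i]) h :
  square_series (l *: h) = (fun n => normc l ^+ 2 * square_series h n).
Proof.
apply/funext => N; rewrite /square_series /series /= mulr_sumr.
apply: eq_bigr => i _.
by rewrite -[X in normc X]/(l * h i) normcM exprMn.
Qed.

Let square_series_cst0 : square_series 0 = cst 0.
Proof.
apply/funext => N; rewrite /square_series /series /= big1// => i _.
by rewrite expr0n /= addr0 sqrtr0 expr0n.
Qed.

Let square_summableZ (l : R[i]) h :
  square_summable h -> square_summable (l *: h).
Proof.
move=> sh; rewrite /square_summable square_seriesZ.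
by apply: is_cvgM; [exact: is_cvg_cst|exact: sh].
Qed.

Let square_summableD h1 h2 :
  square_summable h1 -> square_summable h2 -> square_summable (h1 + h2).
Proof.
move=> s1 s2; apply: (@summableP _ (square_norm h1 + square_norm h2)) => N.
by rewrite (le_trans (pnorm_triangle _ _ _))// lerD// pnorm_le.
Qed.

Lemma ell2_submod_closed : submod_closed ell2_pred.
Proof.
split=> [|l h1 h2 /asboolP s1 /asboolP s2]; apply/asboolP.
  by rewrite /square_summable square_series_cst0; exact: is_cvg_cst.
by apply: square_summableD => //; exact: square_summableZ.
Qed.

HB.instance Definition _ :=
  GRing.isSubmodClosed.Build R[i] (nat -> R[i]) ell2_pred ell2_submod_closed.

Record ell2 := Ell2 {
  ell2_val :> nat -> R[i];
  ell2_valP : ell2_val \in ell2_pred }.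

HB.instance Definition _ := [isSub for ell2_val].
HB.instance Definition _ := [Choice of ell2 by <:].
HB.instance Definition _ := [SubChoice_isSubLmodule of ell2 by <:].

Definition ell2_norm (x : ell2) : R[i] := (square_norm x)%:C.

Let ell2_summable (x : ell2) : square_summable x.
Proof. exact/asboolP/ell2_valP. Qed.

Lemma ell2_normD (x y : ell2) : ell2_norm (x + y) <= ell2_norm x + ell2_norm y.
Proof.
rewrite -rmorphD /= lecR; apply: square_norm_le => N.
by rewrite (le_trans (pnorm_triangle _ _ _))// lerD// pnorm_le.
Qed.

Lemma ell2_normZ (l : R[i]) (x : ell2) :
  ell2_norm (l *: x) = `|l| * ell2_norm x.
Proof.
rewrite /ell2_norm (_ : `|l| = (normc l)%:C)// -rmorphM /=; congr (_%:C).
rewrite /square_norm square_seriesZ.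
have -> : limn (fun n => normc l ^+ 2 * square_series x n) =
          normc l ^+ 2 * limn (square_series x).
  by apply: cvg_lim => //; apply: cvgM; [exact: cvg_cst|exact: ell2_summable].
by rewrite sqrtrM ?sqr_ge0// sqrtr_sqr ger0_norm.
Qed.

Lemma ell2_norm0_eq0 (x : ell2) : ell2_norm x = 0 -> x = 0.
Proof.
move=> [x0]; apply/val_inj/funext => n /=; apply: eq0_normc; apply/eqP.
have := pnorm_le n.+1 (@ell2_summable x); rewrite x0 /pnorm => x0'.
have : square_series x n.+1 = 0.
  by apply/eqP; rewrite eq_le square_series_ge0 andbT -sqrtr_eq0 eq_le x0' sqrtr_ge0.
move/eqP; rewrite square_seriesS paddr_eq0 ?sqr_ge0//.
by move=> /andP[_]; rewrite sqrf_eq0.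
Qed.

HB.instance Definition _ :=
  Lmodule_isNormed.Build R[i] ell2 ell2_normD ell2_normZ ell2_norm0_eq0.

Lemma ell2_delta_subproof (n : nat) :
  (fun k => (k == n)%:R : R[i]) \in ell2_pred.
Proof.
apply/asboolP/(@summableP _ 1) => N; rewrite -[leRHS]sqrtr1 ler_wsqrtr//.
rewrite /square_series /series /=.
have e k : normc (k == n)%:R ^+ 2 = (k == n)%:R :> R.
  by case: (k == n); rewrite ?normc1 ?normc0 ?expr1n ?expr0n.
under eq_bigr do rewrite e.
have [nN|Nn] := ltnP n N.
  rewrite (bigD1_seq n) ?mem_index_iota ?iota_uniq//= eqxx big1 ?addr0//.
  by move=> k /negPf ->.
rewrite big_nat big1// => k /= kN; case: eqP => // kn.
by move: kN; rewrite kn ltnNge Nn.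
Qed.

Definition ell2_basis (n : nat) : ell2 := Ell2 (ell2_delta_subproof n).

Definition is_weighted_shift (lam : nat -> R) (W : {linear ell2 -> ell2}) :
    Prop :=
  bounded_operator W /\
  forall n, W (ell2_basis n) = (lam n)%:C *: ell2_basis n.+1.

Definition hat_seq (lam : nat -> R) (n : nat) : R :=
  \prod_(k < n) lam k ^+ 2.

End ell2.

(* Main.v *)
From HB Require Import structures.
Require Import Defs.
From mathcomp Require Import all_boot all_order all_algebra.
From mathcomp Require Import all_classical all_reals all_analysis.
From mathcomp Require Import measurable_realfun complex zify ring lra.

Import Order.TTheory GRing.Theory Num.Theory.
Import numFieldNormedType.Exports.

Local Open Scope classical_set_scope.
Local Open Scope ring_scope.

(** Since Q_(n+2) - 2 Q_(n+1) + Q_n = X^n, the second difference of gamma is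
the moment sequence 2 c + \int x^n dnu(x), that is, the moment sequence of the
positive measure nu + 2 c delta_1, which lives on some [0, M] with M >= 1.
Both halves of the theorem come from this one fact.

Positivity. Let L be the linear functional on polynomials that sends X^n to
gamma_n. A vector a with zero sum is the coefficient vector of a polynomial
p = (X - 1) q, and the quadratic form of the shifted sequence gamma_(n+s) at a
is L (p^2 X^s) = L ((X - 1)^2 q^2 X^s). Multiplication by (X - 1)^2 amounts to
taking second differences of the sequence, so this number equals
2 c q(1)^2 + \int x^s q(x)^2 dnu(x) >= 0: every shift of gamma is conditionally
positive definite ([shift_quadratic_form_ge0],
[moment_functional_Q_representation_ge0]). For a weighted shift,
||W^n h||^2 is the sum over k of |h_k|^2 gamma_(n+k) / gamma_k, a limit of
nonnegative combinations of shifts of gamma, hence conditionally positive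
definite as well ([weighted_shift_cpd]).

Boundedness. The second differences m_n of gamma satisfy 0 <= m_n and
m_(n+1) <= M m_n. Thus gamma is convex: either it is nonincreasing, and the
ratios gamma_(n+1) / gamma_n are at most 1, or it grows at least linearly, and
then the estimate gamma_(n+1) <= M gamma_n + K (n + 1), obtained by summing
m_(n+1) <= M m_n twice, bounds the ratios ([succ_ratio_bounded]).

The operator W is only given as a bounded linear map with prescribed values on
the standard basis. Its action on coordinates is recovered by approximating a
vector by its truncations ([bounded_operator_coord]). *)

(** * The polynomials Q_n and moment functionals *)

(** The truncated subtraction makes this formula valid for every j, including
the indices above the degree and the cases n = 0, 1. *)
Lemma coef_Qpoly (R : realType) (n j : nat) :
  (Qpoly R n)`_j = (n - j - 1)%N%:R.
Proof.
rewrite /Qpoly -(poly_def _ (fun j => (n - j - 1)%N%:R)) coef_poly; case: ltnP => // nj.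
by rewrite (_ : (n - j - 1)%N = 0%N)//; lia.
Qed.

(** This identity ties the representation of gamma to moments of nu. *)
Lemma Qpoly_second_difference (R : realType) (n : nat) :
  Qpoly R n.+2 - Qpoly R n.+1 *+ 2 + Qpoly R n = 'X^n.
Proof.
apply/polyP => j; rewrite !(coefD, coefN, coefMn) !coef_Qpoly coefXn.
have [jn|nj|->] := ltngtP j n.
- have -> : (n.+2 - j - 1 = (n - j - 1).+2)%N by lia.
  have -> : (n.+1 - j - 1 = (n - j - 1).+1)%N by lia.
  by rewrite mulr0n; move: (n - j - 1)%N => t; rewrite -(natr1 t.+1) -(natr1 t); ring.
- have -> : (n.+2 - j - 1 = 0)%N by lia.
  have -> : (n.+1 - j - 1 = 0)%N by lia.
  have -> : (n - j - 1 = 0)%N by lia.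
  by rewrite !(addr0, subr0).
- have -> : (n.+2 - n - 1 = 1)%N by lia.
  have -> : (n.+1 - n - 1 = 0)%N by lia.
  have -> : (n - n - 1 = 0)%N by lia.
  by rewrite !(addr0, subr0).
Qed.

Definition moment_functional {R : realType} (g : nat -> R) (p : {poly R}) : R :=
  \sum_(i < size p) p`_i * g i.

Lemma moment_functionalE {R : realType} (g : nat -> R) (n : nat) (p : {poly R}) :
  (size p <= n)%N -> moment_functional g p = \sum_(i < n) p`_i * g i.
Proof.
move=> pn; rewrite /moment_functional (big_ord_widen _ (fun i => p`_i * g i) pn).
rewrite big_mkcond /=; apply: eq_bigr => i _; case: ltnP => // pi.
by rewrite nth_default// mul0r.
Qed.

Lemma moment_functional_is_scalar {R : realType} (g : nat -> R) :
  scalar (moment_functional g).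
Proof.
move=> a p q; pose n := maxn (size (a *: p + q)) (maxn (size p) (size q)).
rewrite !(@moment_functionalE _ g n) ?leq_max ?leqnn ?orbT//.
rewrite mulr_sumr -big_split /=; apply: eq_bigr => i _.
by rewrite coefD coefZ; ring.
Qed.

HB.instance Definition _ (R : realType) (g : nat -> R) :=
  GRing.isLinear.Build R {poly R} R *%R (moment_functional g)
    (moment_functional_is_scalar g).

Lemma moment_functionalXn {R : realType} (g : nat -> R) (n : nat) :
  moment_functional g 'X^n = g n.
Proof.
rewrite /moment_functional size_polyXn big_ord_recr /= coefXn eqxx mul1r.
rewrite big1 ?add0r// => i _; rewrite coefXn.
by rewrite (ltn_eqF (ltn_ord i)) mul0r.
Qed.

(** Phrased for bare functions, since linearity of an integral is available only
under integrability hypotheses. *)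
Lemma scalar_poly_eq {R : realType} (f g : {poly R} -> R) :
  scalar f -> scalar g -> (forall n, f 'X^n = g 'X^n) -> f =1 g.
Proof.
move=> sf sg fg p.
pose F : {scalar {poly R}} := HB.pack f (GRing.isLinear.Build _ _ _ _ f sf).
pose G : {scalar {poly R}} := HB.pack g (GRing.isLinear.Build _ _ _ _ g sg).
rewrite -[LHS]/(F p) -[RHS]/(G p) -(coefK p) poly_def !linear_sum.
by apply: eq_bigr => i _; rewrite !linearZ /= fg.
Qed.

(** * Integration of polynomials against a compactly supported measure *)

Lemma compactly_supported_tail (R : realType)
    (nu : {measure set (measurableTypeR R) -> \bar R}) :
  compactly_supported nu -> exists2 M : R, 1 <= M & nu `]M, +oo[%classic = 0%E.
Proof.
case=> K cK nuK; have [A [_ KA]] := compact_bounded cK.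
exists (Num.max 1 (A + 1)); first by rewrite le_max lexx.
apply: (subset_measure0 _ _ _ nuK) => //.
  by apply: measurableC; exact: compact_measurable.
move=> x /=; rewrite in_itv/= andbT gt_max => /andP[_ Ax] Kx.
have := KA (A + 1); rewrite ltrDl => /(_ ltr01 x Kx) /=.
by rewrite leNgt (lt_le_trans Ax (ler_norm _)).
Qed.

(** A finite measure without mass on ]M, +oo[ integrates every polynomial, and sees only
the values of the polynomial on [0, M]. *)
Section poly_integral.
Context {R : realType} (nu : {finite_measure set (measurableTypeR R) -> \bar R}).
Context {M : R} (nuM : nu `]M, +oo[%classic = 0%E).

Let setD_tail : `[0, +oo[%classic `\` `]M, +oo[%classic = `[0, M]%classic :> set R.
Proof.
apply/seteqP; split=> x /=; rewrite !in_itv/= !andbT.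
  by move=> [-> /negP]; rewrite -leNgt.
by move=> /andP[-> xM]; split=> //; apply/negP; rewrite -leNgt.
Qed.

Lemma integrable_poly (p : {poly R}) :
  nu.-integrable `[0, +oo[%classic (EFin \o horner p).
Proof.
apply: (iffRL (@negligible_integrable _ (measurableTypeR R) _ nu _
  `]M, +oo[%classic _ _ _ _ _)) => //.
  by apply/measurable_EFinP; exact: measurable_poly.
rewrite setD_tail; apply: measurable_bounded_integrable => //.
- by rewrite ltey_eq fin_num_measure.
- exact: measurable_poly.
- have /compact_bounded : compact (horner p @` `[0, M]%classic).
    apply: continuous_compact (@segment_compact _ _ _).
    by apply: continuous_subspaceT; exact: continuous_horner.
  case=> A [rA hA]; exists A; split=> // y Ay x Dx; apply: hA Ay _ _.
  by exists x.
Qed.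

Lemma poly_integral_is_scalar :
  scalar (fun p : {poly R} => \int[nu]_(x in `[0, +oo[) p.[x]).
Proof.
move=> a p q; under eq_Rintegral do rewrite hornerD hornerZ.
have ip := integrable_poly p; have iq := integrable_poly q.
have iap : nu.-integrable `[0, +oo[%classic (EFin \o (fun x => a * p.[x])).
  rewrite (_ : _ \o _ = EFin \o horner (a *: p)); first exact: integrable_poly.
  by apply/funext => x /=; rewrite hornerZ.
by rewrite RintegralD// RintegralZl.
Qed.

Lemma poly_integral_ge0 (p : {poly R}) :
  (forall x, 0 <= x <= M -> 0 <= p.[x]) ->
  0 <= \int[nu]_(x in `[0, +oo[) p.[x].
Proof.
move=> p0; rewrite /Rintegral.
rewrite (negligible_integral (T := measurableTypeR R) (mu := nu) (N := `]M, +oo[%classic))//.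
  rewrite setD_tail; apply: Rintegral_ge0 => x /=.
  by rewrite in_itv; exact: p0.
exact: integrable_poly.
Qed.

End poly_integral.

(** * Conditional positive definiteness from second differences *)

Definition second_difference {R : realType} (g : nat -> R) (n : nat) : R :=
  g n.+2 - g n.+1 *+ 2 + g n.

(** Multiplication of polynomials by X acts on sequences as the backward shift, so
multiplication by (X - 1)^2 acts as the second difference. *)
Lemma moment_functional_second_difference {R : realType} (g : nat -> R)
    (r : {poly R}) :
  moment_functional g (('X - 1) ^+ 2 * r) =
  moment_functional (second_difference g) r.
Proof.
move: r; apply: scalar_poly_eq => [a p q|a p q|n].
- by rewrite mulrDr -scalerAr linearP.
- exact: linearP.
- have -> : ('X - 1) ^+ 2 * 'X^n = 'X^(n.+2) - 'X^(n.+1) *+ 2 + 'X^n :> {poly R}.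
    by rewrite !exprS; ring.
  by rewrite linearD linearB linearMn /= !moment_functionalXn.
Qed.

(** A Hankel form is the moment functional evaluated at a square; the factor X^s
shifts the sequence by s. *)
Lemma moment_functional_sqr {R : realType} (g : nat -> R) (s k : nat)
    (a : 'I_k -> R) (p := \sum_(i < k) a i *: 'X^i) :
  moment_functional g (p ^+ 2 * 'X^s) =
  \sum_(i < k) \sum_(j < k) g (i + j + s)%N * a i * a j.
Proof.
have -> : p ^+ 2 * 'X^s =
    \sum_(i < k) \sum_(j < k) (a i * a j) *: 'X^(i + j + s) :> {poly R}.
  rewrite expr2 {1}/p mulr_suml mulr_suml; apply: eq_bigr => i _.
  rewrite /p mulr_sumr mulr_suml; apply: eq_bigr => j _.
  by rewrite !exprD -scalerAl -scalerAr scalerA -!scalerAl.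
rewrite linear_sum; apply: eq_bigr => i _.
rewrite linear_sum; apply: eq_bigr => j _.
by rewrite linearZ /= moment_functionalXn -mulrA mulrC.
Qed.

(** The zero-sum condition says that the polynomial with coefficients a vanishes at
1, which yields the factor (X - 1)^2 in its square. *)
Lemma shift_quadratic_form_ge0 {R : realType} (g : nat -> R) (s k : nat)
    (a : 'I_k -> R) :
  (forall q : {poly R},
    0 <= moment_functional (second_difference g) (q ^+ 2 * 'X^s)) ->
  \sum_(i < k) a i = 0 ->
  0 <= \sum_(i < k) \sum_(j < k) g (i + j + s)%N * a i * a j.
Proof.
move=> g0 a0; rewrite -moment_functional_sqr.
set p := \sum_(i < k) _; have /factor_theorem[q ->] : root p 1.
  rewrite /root /p horner_sum -[X in _ == X]a0; apply/eqP/eq_bigr => i _.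
  by rewrite hornerZ hornerXn expr1n mulr1.
by rewrite exprMn mulrAC mulrC polyC1 moment_functional_second_difference.
Qed.

(** For complex a = x + i y, the Hermitian form splits into the forms at x and at y,
and its imaginary part vanishes because g (i + j) is symmetric in i and j. *)
Lemma cpd_seq_real {R : realType} (g : nat -> R) :
  (forall k (a : 'I_k.+1 -> R), \sum_(i < k.+1) a i = 0 ->
    0 <= \sum_(i < k.+1) \sum_(j < k.+1) g (i + j)%N * a i * a j) ->
  cpd_seq g.
Proof.
move=> g0 k a a0.
pose re i := complex.Re (a i); pose im i := complex.Im (a i).
have re0 : \sum_(i < k.+1) re i = 0.
  by rewrite -(raddf_sum (@complex.Re R)) a0.
have im0 : \sum_(i < k.+1) im i = 0.
  by rewrite -(raddf_sum (@complex.Im R)) a0.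
set S := (X in 0 <= X).
have -> : S = (\sum_(i < k.+1) \sum_(j < k.+1) g (i + j)%N * re i * re j +
    \sum_(i < k.+1) \sum_(j < k.+1) g (i + j)%N * im i * im j)%:C%C.
  apply/eqP; rewrite eq_complex; apply/andP; split; apply/eqP.
    rewrite (raddf_sum (@complex.Re R)) /= -big_split; apply: eq_bigr => i _.
    rewrite (raddf_sum (@complex.Re R)) /= -big_split; apply: eq_bigr => j _.
    rewrite /re /im; case: (a i) => x y; case: (a j) => z t /=; ring.
  pose T := \sum_(i < k.+1) \sum_(j < k.+1) g (i + j)%N * im i * re j.
  transitivity (T - T); last by rewrite subrr.
  rewrite {2}/T exchange_big -sumrB (raddf_sum (@complex.Im R)) /=.
  apply: eq_bigr => i _; rewrite -sumrB (raddf_sum (@complex.Im R)) /=.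
  apply: eq_bigr => j _; rewrite (addnC j) /re /im.
  by case: (a i) => x y; case: (a j) => z t /=; ring.
by rewrite -(rmorph0 (real_complex R)) lecR addr_ge0 ?g0.
Qed.

(** * Boundedness of the ratios of consecutive terms *)

(** The sequence g is convex. If it never increases, the constant 1 works.
Otherwise it grows at least linearly from some index N on, which absorbs the
linear error term K (n + 1) in g (n + 1) <= M g n + K (n + 1); the finitely many
ratios before N are bounded by their sum. *)
Lemma succ_ratio_bounded {R : realType} (g : nat -> R) (M : R) :
    (forall n, 0 < g n) -> (forall n, 0 <= second_difference g n) ->
    (forall n, second_difference g n.+1 <= M * second_difference g n) ->
  exists C : R, forall n, g n.+1 <= C * g n.
Proof.
move=> g0 m0 mM; pose D n := g n.+1 - g n.
have DS n : D n.+1 = D n + second_difference g n.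
  by rewrite /D /second_difference; ring.
have [D0|/existsNP[N /negP]] := pselect (forall n, D n <= 0).
  by exists 1 => n; rewrite mul1r -subr_le0; exact: D0.
rewrite -ltNge => DN.
have glin t : g N + D N * t%:R <= g (N + t)%N.
  have DNt s : D N <= D (N + s)%N.
    elim: s => [|s IH]; first by rewrite addn0.
    by rewrite addnS DS (le_trans IH)// lerDl.
  elim: t => [|t IH]; first by rewrite addn0 mulr0 addr0.
  have := DNt t; rewrite {2}/D addnS -natr1; lra.
(* D (n + 1) - M D n is nonincreasing in n, its increments being
   m_(n+1) - M m_n for the second difference m of g; hence it stays below its value at 0. *)
have DM n : D n.+1 - M * D n <= D 1%N - M * D 0%N.
  elim: n => // n IH; apply: le_trans IH.
  by have := mM n; rewrite !DS; lra.
pose E n := g n.+1 - M * g n.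
pose K := Num.max `|E 0%N| `|D 1%N - M * D 0%N|.
have EK n : E n <= K * n.+1%:R.
  elim: n => [|n IH].
    by rewrite mulr1 (le_trans (ler_norm _))// le_max lexx.
  have : D n.+1 - M * D n <= K.
    by rewrite (le_trans (DM n))// (le_trans (ler_norm _))// le_max lexx orbT.
  by move: IH; rewrite -[in X in _ -> _ -> X]natr1 /E /D; lra.
have K0 : 0 <= K by rewrite le_max normr_ge0.
pose S := \sum_(i < N) g i.+1 / g i.
have S0 : 0 <= S by apply: sumr_ge0 => i _; rewrite divr_ge0// ltW.
pose A := K * N.+1%:R / g N; pose B := K / D N.
have A0 : 0 <= A by rewrite divr_ge0 ?mulr_ge0// ltW.
have B0 : 0 <= B by rewrite divr_ge0// ltW.
exists (S + (`|M| + A + B)) => n; have [nN|Nn] := ltnP n N.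
  have : g n.+1 / g n <= S.
    rewrite /S (bigD1 (Ordinal nN))//= lerDl sumr_ge0// => i _.
    by rewrite divr_ge0// ltW.
  rewrite ler_pdivrMr// => /le_trans; apply; rewrite ler_pM2r//.
  by rewrite lerDl !addr_ge0.
have [t ->] : exists t, n = (N + t)%N by exists (n - N)%N; rewrite subnKC.
have gt0 := g0 (N + t)%N.
(* The error term K (N + 1 + t) is compared with g N + D N t <= g (N + t): A
   handles the constant part and B the linear one. *)
have Agt : K * N.+1%:R + K * t%:R <= (A + B) * g (N + t)%N.
  have -> : K * N.+1%:R + K * t%:R = A * g N + B * (D N * t%:R).
    by rewrite /A /B; field; rewrite !gt_eqF.
  have Dt0 : 0 <= D N * t%:R by rewrite mulr_ge0// ltW.
  have gN0 := ltW (g0 N).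
  have le1 : A * g N <= A * g (N + t)%N.
    by rewrite ler_wpM2l//; apply: le_trans (glin t); rewrite lerDl.
  have le2 : B * (D N * t%:R) <= B * g (N + t)%N.
    by rewrite ler_wpM2l//; apply: le_trans (glin t); rewrite lerDr.
  by rewrite (mulrDl A) lerD.
have := EK (N + t)%N; rewrite -addSn natrD mulrDr /E => En.
have SM : 0 <= S * g (N + t)%N by rewrite mulr_ge0// ltW.
have MM : M * g (N + t)%N <= `|M| * g (N + t)%N by rewrite ler_pM2r// ler_norm.
by move: Agt En SM MM; rewrite !mulrDl; lra.
Qed.

(** * Coordinates and bounded operators on the space of square summable sequences *)

Section ell2_facts.
Context {R : realType}.
Implicit Types (x y h : ell2 R) (n j k N : nat).

Lemma normcR (a : R) : Normc.normc a%:C%C = `|a|.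
Proof. by rewrite /= expr0n addr0 sqrtr_sqr. Qed.

Lemma ell2BE x y n : (x - y) n = x n - y n.
Proof. by []. Qed.

Lemma ell2ZE (a : R[i]) x n : (a *: x) n = a * x n.
Proof. by []. Qed.

Lemma ell2_basisE n j : ell2_basis R n j = (j == n)%:R.
Proof. by []. Qed.

Lemma ell2_sumE (I : Type) (s : seq I) (F : I -> ell2 R) n :
  (\sum_(i <- s) F i) n = \sum_(i <- s) F i n.
Proof. by elim/big_rec2: _ => // i a b _ <-. Qed.

Lemma square_seriesS (h : nat -> R[i]) N :
  square_series h N.+1 = square_series h N + Normc.normc (h N) ^+ 2.
Proof. by rewrite /square_series /series /= big_nat_recr. Qed.

Lemma nondecreasing_square_series (h : nat -> R[i]) :
  nondecreasing_seq (square_series h).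
Proof.
by apply/nondecreasing_seqP => n; rewrite square_seriesS lerDl sqr_ge0.
Qed.

Lemma square_series_ge0 (h : nat -> R[i]) N : 0 <= square_series h N.
Proof. by apply: sumr_ge0 => i _; exact: sqr_ge0. Qed.

Lemma square_series_cvg h : square_series h @ \oo --> square_norm h ^+ 2.
Proof.
have sh : square_summable h by exact/asboolP/ell2_valP.
rewrite sqr_sqrtr//; apply: limr_ge => //.
by apply: nearW => N; exact: square_series_ge0.
Qed.

Lemma square_series_le h N : square_series h N <= square_norm h ^+ 2.
Proof.
rewrite -(cvg_lim _ (square_series_cvg h))//.
apply: nondecreasing_cvgn_le; first exact: nondecreasing_square_series.
by apply/cvg_ex; eexists; exact: square_series_cvg.
Qed.

Lemma normc_coord_le h n : Normc.normc (h n) ^+ 2 <= square_norm h ^+ 2.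
Proof.
apply: le_trans (square_series_le h n.+1).
by rewrite square_seriesS lerDr square_series_ge0.
Qed.

Lemma bounded_operator_square_norm (T : {linear ell2 R -> ell2 R}) :
  bounded_operator T ->
  exists M : R, forall h, square_norm (T h) ^+ 2 <= M * square_norm h ^+ 2.
Proof.
move=> [M TM]; exists (M ^+ 2) => h; rewrite -exprMn.
have : square_norm (T h) <= M * square_norm h by rewrite -lecR rmorphM; exact: TM.
by move=> le; rewrite lerXn2r// nnegrE ?sqrtr_ge0// (le_trans _ le)// sqrtr_ge0.
Qed.

Definition truncation h N : ell2 R := \sum_(k < N) h k *: ell2_basis R k.

Lemma truncationE h N j : truncation h N j = if (j < N)%N then h j else 0.
Proof.
rewrite ell2_sumE; under eq_bigr do rewrite ell2ZE ell2_basisE.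
case: ltnP => jN.
  rewrite (bigD1 (Ordinal jN))//= eqxx mulr1 big1 ?addr0// => i ij.
  rewrite (_ : (j == i) = false) ?mulr0//.
  by apply/eqP => ji; move/eqP: ij; apply; apply/val_inj.
rewrite big1// => i _; rewrite (_ : (j == i) = false) ?mulr0//.
by apply/eqP => ji; move: (ltn_ord i); rewrite -ji ltnNge jN.
Qed.

Lemma square_norm_sub_truncation h N :
  square_norm (h - truncation h N) ^+ 2 = square_norm h ^+ 2 - square_series h N.
Proof.
have c1 := square_series_cvg (h - truncation h N).
have c2 : (fun t => square_series h t - square_series h N) @ \oo -->
    square_norm h ^+ 2 - square_series h N.
  by apply: cvgB; [exact: square_series_cvg|exact: cvg_cst].
apply: (cvg_unique _ c1) => //; apply: cvg_trans c2; apply: near_eq_cvg.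
near=> t; have Nt : (N <= t)%N by near: t; exact: nbhs_infty_ge.
rewrite /square_series /series /=
  [in LHS](big_cat_nat (leq0n N) Nt)//= addrAC subrr add0r.
rewrite [RHS](big_cat_nat (leq0n N) Nt)//= [X in _ = X + _]big_nat.
rewrite [X in _ = X + _]big1 ?add0r => [|k /andP[_ kN]].
  apply: eq_big_nat => k /andP[Nk _].
  rewrite -[X in _ = X ^+ _]/(Normc.normc (h k - truncation h N k)).
  by rewrite truncationE ltnNge Nk subr0.
rewrite -[X in X ^+ _]/(Normc.normc (h k - truncation h N k)).
by rewrite truncationE kN subrr Normc.normc0 expr0n.
Unshelve. all: by end_near. Qed.

(** The truncations of h converge to h in norm, because the square of their distance
is the tail of a convergent series; boundedness of T and of the coordinate maps
then determines T h from the values of T on the basis. The eventual constancy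
required here holds whenever each coordinate of T h involves finitely many
coordinates of h. *)
Lemma bounded_operator_coord (T : {linear ell2 R -> ell2 R}) h j (z : R[i]) :
  bounded_operator T ->
  (\forall N \near \oo, \sum_(k < N) h k * T (ell2_basis R k) j = z) ->
  T h j = z.
Proof.
move=> /bounded_operator_square_norm[M TM] Tz.
have TN N : T (truncation h N) j = \sum_(k < N) h k * T (ell2_basis R k) j.
  rewrite linear_sum ell2_sumE; apply: eq_bigr => k _.
  by rewrite linearZ ell2ZE.
apply/eqP; rewrite -subr_eq0; apply/eqP/Normc.eq0_normc.
apply/eqP; rewrite -sqrf_eq0 eq_le sqr_ge0 andbT.
have M0 : (fun N => M * (square_norm h ^+ 2 - square_series h N)) @ \oo --> (0 : R).
  rewrite -(mulr0 M) -[X in _ * X](subrr (square_norm h ^+ 2)).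
  by apply: cvgMr; apply: cvgB; [exact: cvg_cst|exact: square_series_cvg].
rewrite -(cvg_lim _ M0)//; apply: limr_ge.
  by apply/cvg_ex; eexists; exact: M0.
near=> N.
have <- : T (truncation h N) j = z by rewrite TN; near: N.
rewrite -square_norm_sub_truncation; apply: le_trans (TM _).
by rewrite linearB -ell2BE; exact: normc_coord_le.
Unshelve. all: by end_near. Qed.

End ell2_facts.

(** * Weighted shifts *)

Section weighted_shift.
Context {R : realType} (lam : nat -> R).
Implicit Types (h : ell2 R) (W : {linear ell2 R -> ell2 R}) (n k N : nat).

Definition shift_seq (h : nat -> R[i]) n : R[i] :=
  if n is m.+1 then (lam m)%:C%C * h m else 0.

Lemma square_series_shift (B : R) (h : ell2 R) N :
  (forall n, `|lam n| <= B) ->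
  square_series (shift_seq h) N <= B ^+ 2 * square_norm h ^+ 2.
Proof.
move=> lamB.
have B0 : 0 <= B by rewrite (le_trans _ (lamB 0%N)).
have le0 : 0 <= B ^+ 2 * square_norm h ^+ 2 by rewrite mulr_ge0 ?sqr_ge0.
case: N => [|N]; first by rewrite /square_series /series /= big_geq.
rewrite /square_series /series /= big_nat_recl// [shift_seq h 0]/= Normc.normc0 expr0n add0r.
apply: (@le_trans _ _ (B ^+ 2 * square_series h N)); last first.
  by rewrite ler_wpM2l ?sqr_ge0// square_series_le.
rewrite mulr_sumr; apply: ler_sum => k _.
rewrite Normc.normcM exprMn normcR ler_wpM2r ?sqr_ge0//.
by rewrite lerXn2r// nnegrE.
Qed.

Lemma weighted_shift_exists :
  bounded_fun lam -> exists W, is_weighted_shift lam W.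
Proof.
move=> [A [_ lamA]]; pose B := A + 1.
have lamB n : `|lam n| <= B.
  by have := lamA B; rewrite ltrDl => /(_ ltr01 n I).
have sS h : shift_seq h \in @ell2_pred R.
  apply/asboolP/nondecreasing_is_cvgn; first exact: nondecreasing_square_series.
  exists (B ^+ 2 * square_norm h ^+ 2) => _ [N _ <-].
  exact: square_series_shift.
pose f h := Ell2 (sS h).
have lf : linear f.
  move=> a x y; apply/val_inj/funext => -[|n].
    by rewrite -[RHS]/(a * 0 + 0) mulr0 addr0.
  rewrite -[LHS]/((lam n)%:C%C * (a * x n + y n)).
  by rewrite -[RHS]/(a * ((lam n)%:C%C * x n) + (lam n)%:C%C * y n); ring.
pose W : {linear ell2 R -> ell2 R} :=
  HB.pack f (GRing.isLinear.Build _ _ _ _ f lf).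
exists W; split.
  exists B => h; rewrite -[leLHS]/((square_norm (f h))%:C%C).
  rewrite -[`|h|]/((square_norm h)%:C%C) -rmorphM lecR.
  have B0 : 0 <= B by rewrite (le_trans _ (lamB 0%N)).
  rewrite -(@ler_pXn2r _ 2)// ?nnegrE ?mulr_ge0 ?sqrtr_ge0// exprMn.
  rewrite -(cvg_lim _ (square_series_cvg (f h)))//; apply: limr_le.
    by apply/cvg_ex; eexists; exact: square_series_cvg.
  by apply: nearW => N; exact: square_series_shift.
move=> n; apply/val_inj/funext => -[|m].
  by rewrite -[RHS]/((lam n)%:C%C * 0) mulr0.
rewrite -[LHS]/((lam m)%:C%C * (m == n)%:R) -[RHS]/((lam n)%:C%C * (m == n)%:R).
by case: eqP => [->//|_]; rewrite !mulr0.
Qed.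

Section coordinates.
Context {W} (wW : is_weighted_shift lam W).

(** A bounded operator with the prescribed values on the basis is the coordinatewise
shift, so the weighted shift is unique. *)
Lemma weighted_shift_coord h : W h = shift_seq h :> (nat -> R[i]).
Proof.
have [bW We] := wW; apply/funext => -[|n]; apply: bounded_operator_coord => //;
  near=> N; under eq_bigr do rewrite We ell2ZE ell2_basisE.
  by rewrite big1// => k _; rewrite !mulr0.
have nN : (n < N)%N by near: N; exact: nbhs_infty_gt.
rewrite (bigD1 (Ordinal nN))//= eqxx mulr1 big1 ?addr0 1?[LHS]mulrC// => k nk.
rewrite eqSS (_ : (n == k) = false) ?mulr0//.
by apply/eqP => ji; move/eqP: nk; apply; apply/val_inj.
Unshelve. all: by end_near. Qed.

Lemma iter_weighted_shift_low n h j : (j < n)%N -> iter n W h j = 0.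
Proof.
elim: n j => // n IH [|j] jn; rewrite iterS weighted_shift_coord//=.
by rewrite IH ?mulr0.
Qed.

Lemma normc_iter_weighted_shift n h k : (forall i, lam i != 0) ->
  Normc.normc (iter n W h (k + n)%N) ^+ 2 =
  hat_seq lam (k + n) / hat_seq lam k * Normc.normc (h k) ^+ 2.
Proof.
move=> lam0.
have hat0 i : hat_seq lam i != 0.
  by apply/prodf_neq0 => j _; rewrite sqrf_eq0.
elim: n => [|n IH]; first by rewrite addn0 divff// mul1r.
rewrite iterS weighted_shift_coord addnS /= Normc.normcM exprMn IH normcR.
by rewrite /hat_seq big_ord_recr /= real_normK ?num_real//; ring.
Qed.

(** The N-th partial sum here is the (N + n)-th one of the norm of W^n h, because
the first n coordinates of W^n h vanish. *)
Lemma square_norm_iter_cvg n h : (forall i, lam i != 0) ->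
  (fun N => \sum_(k < N) hat_seq lam (n + k) / hat_seq lam k *
     Normc.normc (h k) ^+ 2) @ \oo --> square_norm (iter n W h) ^+ 2.
Proof.
move=> lam0; rewrite (_ : (fun N => _) =
    [sequence square_series (iter n W h) (N + n)%N]_N).
  by rewrite (cvg_shiftn n); exact: square_series_cvg.
apply/funext => N; rewrite /square_series /series /=.
rewrite (big_cat_nat (leq0n n) (leq_addl N n))//=.
rewrite [X in _ = X + _]big_nat [X in _ = X + _]big1 => [|j /andP[_ jn]].
  rewrite add0r -[X in \sum_(X <= _ < _) _]add0n big_addn addnK big_mkord; apply: eq_bigr => k _.
  by rewrite normc_iter_weighted_shift// addnC.
by rewrite iter_weighted_shift_low// Normc.normc0 expr0n.
Qed.

End coordinates.
End weighted_shift.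

(** The sequence ||W^n h||^2 is a limit of combinations, with nonnegative weights
|h_l|^2 / hat_l, of the shifts by l of the hat sequence, and conditional positive
definiteness survives such combinations and limits. *)
Lemma weighted_shift_cpd {R : realType} (lam : nat -> R)
    (W : {linear ell2 R -> ell2 R}) :
    (forall n, 0 < lam n) -> is_weighted_shift lam W ->
    (forall s k (a : 'I_k -> R), \sum_(i < k) a i = 0 ->
      0 <= \sum_(i < k) \sum_(j < k) hat_seq lam (i + j + s) * a i * a j) ->
  cpd_operator W.
Proof.
move=> lam0 wW hat_cpd h; apply: cpd_seq_real => k a a0.
have hat0 i : 0 < hat_seq lam i by apply: prodr_gt0 => j _; rewrite exprn_gt0.
pose w l : R := Normc.normc (h l) ^+ 2 / hat_seq lam l.
have cvgW n : (fun N => \sum_(l < N) w l * hat_seq lam (n + l)) @ \oo -->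
    (complex.Re `|iter n W h|) ^+ 2.
  rewrite -[complex.Re _]/(square_norm (iter n W h)).
  rewrite (_ : (fun N => _) = fun N => \sum_(l < N)
      hat_seq lam (n + l) / hat_seq lam l * Normc.normc (h l) ^+ 2).
    by apply: square_norm_iter_cvg => // i; rewrite gt_eqF.
  by apply/funext => N; apply: eq_bigr => l _; rewrite /w; ring.
have cvgQ : (fun N => \sum_(i < k.+1) \sum_(j < k.+1)
      (\sum_(l < N) w l * hat_seq lam (i + j + l)) * a i * a j) @ \oo -->
    \sum_(i < k.+1) \sum_(j < k.+1)
      (complex.Re `|iter (i + j) W h|) ^+ 2 * a i * a j.
  apply: cvg_big => [|i _]; first exact: add_continuous.
  apply: cvg_big => [|j _]; first exact: add_continuous.
  by apply: cvgMl; apply: cvgMl; exact: cvgW.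
rewrite -(cvg_lim _ cvgQ)//; apply: limr_ge.
  by apply/cvg_ex; eexists; exact: cvgQ.
apply: nearW => N; rewrite (_ : \sum_(i < k.+1) _ = \sum_(l < N) w l *
    \sum_(i < k.+1) \sum_(j < k.+1) hat_seq lam (i + j + l) * a i * a j).
  apply: sumr_ge0 => l _; apply: mulr_ge0; last exact: hat_cpd.
  by rewrite /w divr_ge0 ?sqr_ge0// ltW.
under [RHS]eq_bigr do rewrite mulr_sumr.
rewrite [RHS]exchange_big; apply: eq_bigr => i _.
under [RHS]eq_bigr do rewrite mulr_sumr.
rewrite [RHS]exchange_big; apply: eq_bigr => j _.
by rewrite !mulr_suml; apply: eq_bigr => l _; rewrite !mulrA.
Qed.

(** * Sequences represented by the polynomials Q_n *)

Section Q_representation.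
Context {R : realType} {nu : {finite_measure set (measurableTypeR R) -> \bar R}}.
Context {M : R} (M1 : 1 <= M) (nuM : nu `]M, +oo[%classic = 0%E).
Context {g : nat -> R} {b c : R} (c0 : 0 <= c).
Context (gE : forall n, g n = 1 + b * n%:R + c * n%:R ^+ 2
  + \int[nu]_(x in `[0, +oo[) (Qpoly R n).[x]).

Let I (p : {poly R}) := \int[nu]_(x in `[0, +oo[) p.[x].
Let sI : scalar I := poly_integral_is_scalar nu nuM.

HB.instance Definition _ := GRing.isLinear.Build R {poly R} R *%R I sI.

Lemma Q_representation0 : g 0%N = 1.
Proof.
rewrite gE -[X in _ + X]/(I _) (_ : Qpoly R 0 = 0).
  by rewrite linear0 mulr0 expr0n mulr0 !addr0.
by apply/polyP => j; rewrite coef_Qpoly coef0.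
Qed.

Lemma second_difference_Q_representation n :
  second_difference g n = 2 * c + I 'X^n.
Proof.
rewrite -Qpoly_second_difference linearD linearB linearMn /=.
by rewrite /second_difference !gE -!natr1 /I; ring.
Qed.

(** The functional of the second difference is integration against
nu + 2 c delta_1. *)
Lemma moment_functional_Q_representation (r : {poly R}) :
  moment_functional (second_difference g) r = 2 * c * r.[1] + I r.
Proof.
move: r; apply: scalar_poly_eq => [|a p q|n].
- exact: moment_functional_is_scalar.
- by rewrite hornerD hornerZ linearP /=; ring.
- rewrite moment_functionalXn second_difference_Q_representation.
  by rewrite hornerXn expr1n mulr1.
Qed.

Lemma moment_functional_Q_representation_ge0 (q : {poly R}) s :
  0 <= moment_functional (second_difference g) (q ^+ 2 * 'X^s).
Proof.
rewrite moment_functional_Q_representation addr_ge0//.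
  by rewrite !mulr_ge0// hornerM hornerXn expr1n mulr1 horner_exp sqr_ge0.
apply: (poly_integral_ge0 nu nuM) => x /andP[x0 _].
by rewrite hornerM horner_exp hornerXn mulr_ge0 ?sqr_ge0 ?exprn_ge0.
Qed.

Lemma second_difference_Q_representation_ge0 n : 0 <= second_difference g n.
Proof.
have := moment_functional_Q_representation_ge0 1 n.
by rewrite expr1n mul1r moment_functionalXn.
Qed.

(** This integrates (M - x) x^n >= 0 on [0, M]; the hypothesis 1 <= M takes care of
the mass 2 c at 1. *)
Lemma second_difference_Q_representationS n :
  second_difference g n.+1 <= M * second_difference g n.
Proof.
rewrite !second_difference_Q_representation.
have : 0 <= I ((M%:P - 'X) * 'X^n).
  apply: (poly_integral_ge0 nu nuM) => x /andP[x0 xM].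
  by rewrite hornerM !hornerE mulr_ge0 ?subr_ge0 ?exprn_ge0.
rewrite mulrBl -exprS mul_polyC linearB linearZ /= => leI.
have := ler_wpM2r c0 M1; lra.
Qed.

End Q_representation.

(** * The weighted shift associated with a represented sequence *)

Theorem theorem4p1 (R : realType) (gamma : nat -> R) (b c : R)
    (nu : {finite_measure set (measurableTypeR R) -> \bar R})
    (hgamma_pos : forall n : nat, 0 < gamma n)
    (hc : 0 <= c)
    (hnu_Rplus : measure_on_Rplus nu)
    (hnu_supp : compactly_supported nu)
    (hnu1 : nu [set 1%R] = 0%E)
    (hgamma : forall n : nat,
       gamma n = 1 + b * n%:R + c * n%:R ^+ 2
                 + \int[nu]_(x in `[0, +oo[) (Qpoly R n).[x])
    (lambda : nat -> R)
    (hlambda : forall n : nat, lambda n = Num.sqrt (gamma n.+1 / gamma n)) :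
  [/\ bounded_fun lambda,
      exists W : {linear ell2 R -> ell2 R}, is_weighted_shift lambda W,
      forall W : {linear ell2 R -> ell2 R},
        is_weighted_shift lambda W -> cpd_operator W
    & hat_seq lambda = gamma].
Proof.
have [M M1 nuM] := compactly_supported_tail _ _ hnu_supp.
have hatE : hat_seq lambda = gamma.
  apply/funext; elim=> [|n IH].
    by rewrite /hat_seq big_ord0 (Q_representation0 nuM hgamma).
  rewrite /hat_seq big_ord_recr /= -[X in X * _]/(hat_seq lambda n) IH hlambda.
  rewrite sqr_sqrtr ?divr_ge0 ?ltW//; field.
  by rewrite gt_eqF.
have bounded_lambda : bounded_fun lambda.
  have [C hC] : exists C, forall n, gamma n.+1 <= C * gamma n.
    apply: (succ_ratio_bounded gamma M) => // n.
      exact: (second_difference_Q_representation_ge0 nuM hc hgamma n).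
    exact: (second_difference_Q_representationS M1 nuM hc hgamma n).
  exists (Num.sqrt C); split=> [|x Cx n _ /=]; first exact: num_real.
  apply: le_trans (ltW Cx); rewrite hlambda ger0_norm ?sqrtr_ge0//.
  by rewrite ler_wsqrtr// ler_pdivrMr.
split=> //; first exact: weighted_shift_exists.
move=> W wW; apply: (weighted_shift_cpd _ _ _ wW) => [n|s k a a0].
  by rewrite hlambda sqrtr_gt0 divr_gt0.
rewrite hatE; apply: (shift_quadratic_form_ge0 _ _ _ _ _ a0) => q.
exact: (moment_functional_Q_representation_ge0 nuM hc hgamma q s).
Qed.
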